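(* Let $n,m,q\ge 1$ and $\tau\ge 1$ be integers, let $A\in\mathbb{R}^{n\times n}$, $B\in\mathbb{R}^{n\times m}$, $F\in\mathbb{R}^{n\times q}$, and let $Q\subseteq\mathbb{R}^n$, $X\subseteq Q$, $U\subseteq\mathbb{R}^m$, $D\subseteq\mathbb{R}^q$ be polytopes. Let $\Sigma_{aug}$ be the system with state $(x,u_1,\dots,u_\tau)\in\mathbb{R}^{n}\times(\mathbb{R}^{m})^{\tau}$, input $u\in U$, disturbance $d\in D$ and dynamics $$x(t+1)=Ax(t)+Bu_1(t)+Fd(t),\quad u_i(t+1)=u_{i+1}(t)\ (1\le i\le\tau-1),\quad u_\tau(t+1)=u(t),$$ and let $S=X\times U^\tau$ be its safe set. Put $D_\tau=\sum_{i=1}^{\tau}A^{i-1}FD$, and let $\Sigma_{aux}$ be the system on $\mathbb{R}^n$ with input $u\in U$, disturbance $d\in D$ and dynamics $$\widehat{x}(t+1)=A\widehat{x}(t)+Bu(t)+A^{\tau}Fd(t).$$ Let $\widehat{C}$ be the maximal controlled invariant set of $\Sigma_{aux}$ within $X\ominus D_\tau$. Define $$C_\tau=\Big\{(x,u_1,\dots,u_\tau)\ \Big|\ A^{\tau}x+\sum_{i=1}^{\tau}A^{i-1}Bu_{\tau-i+1}\in\widehat{C}\Big\},$$ and for $k=0,1,\dots,\tau-1$, $$C_k=\Big\{(x,u_1,\dots,u_\tau)\ \Big|\ A^{k}x+\sum_{i=1}^{k}A^{i-1}Bu_{k-i+1}\in X\ominus\sum_{i=1}^{k}A^{i-1}FD\Big\},$$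 where all tuples range over $\mathbb{R}^{n}\times(\mathbb{R}^{m})^{\tau}$. Let $$C_{ext}=\Big(\bigcap_{i=0}^{\tau}C_i\Big)\cap S.$$ Assume that the maximal controlled invariant sets of $\Sigma_{aux}$ within $X\ominus D_\tau$ and of $\Sigma_{aug}$ within $S$ each equal the limit $V_\infty$ of the corresponding fixed-point iteration. Then $C_{ext}$ is the maximal controlled invariant set of $\Sigma_{aug}$ within $S$.
   Context: For sets $S_1,S_2\subseteq\mathbb{R}^n$: $S_1\ominus S_2=\{x\mid x+y\in S_1\ \forall y\in S_2\}$ is the Minkowski difference, and $\sum_{i}S_i$ denotes the Minkowski sum of a collection of sets, an empty Minkowski sum being $\{0\}$. For a matrix $L$ and a set $D$, $LD=\{Lx\mid x\in D\}$. For a discrete-time system $z(t+1)=f(z(t),u(t),d(t))$ with input set $U$ and disturbance set $D$, and a safe set $Y$ of states, a subset $C\subseteq Y$ is controlled invariant within $Y$ if for every $z\in C$ there exists $u\in U$ such that for all $d\in D$, $f(z,u,d)\in C$ (the disturbance is non-measurable: $u$ is chosen before $d$). The maximal controlled invariant set within $Y$ is the (unique) controlled invariant set within $Y$ containing every controlled invariant set within $Y$, i.e. the union of all of them. Fixed-point iteration: with $Pre(V)=\{z\mid\exists u\in U,\ \forall d\in D,\ f(z,u,d)\in V\}$, set $V_0=Y$, $V_{k+1}=Pre(V_k)\cap Y$; the sets $V_k$ are decreasing and $V_\infty=\bigcap_{k}V_k$. *)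

(* Defs.v *)
From mathcomp Require Import all_boot all_order all_algebra.
From mathcomp Require Import all_classical all_reals all_analysis.

Set Implicit Arguments.
Unset Strict Implicit.
Unset Printing Implicit Defensive.

Import Order.TTheory GRing.Theory Num.Theory numFieldNormedType.Exports.

Local Open Scope classical_set_scope.
Local Open Scope ring_scope.

(* Bounded intersection of finitely many closed half-spaces; it may be empty,
   and it need not have interior points. *)
Definition polytope (R : realType) (n : nat) (P : set 'cV[R]_n) : Prop :=
  bounded_set P /\
  exists (k : nat) (H : 'M[R]_(k, n)) (h : 'cV[R]_k),
    P = [set x | forall i, (H *m x) i 0 <= h i 0].

Definition mink_diff (V : zmodType) (S1 S2 : set V) : set V :=
  [set x | forall y, S2 y -> S1 (x + y)].

(* For k = 0 this is [set 0]. *)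
Definition mink_sum (V : zmodType) (k : nat) (S : 'I_k -> set V) : set V :=
  [set \sum_(i < k) y i | y in [set y : 'I_k -> V | forall i, S i (y i)]].

Record system (Z I W : Type) := System {
  dyn : Z -> I -> W -> Z;
  inputs : set I;
  dists : set W
}.

Section ControlledInvariance.
Context (Z I W : Type) (sys : system Z I W).

Definition pre (V : set Z) : set Z :=
  [set z | exists2 u, inputs sys u & forall d, dists sys d -> V (dyn sys z u d)].

Definition controlled_invariant (Y C : set Z) : Prop :=
  C `<=` Y /\
  forall z, C z ->
    exists2 u, inputs sys u & forall d, dists sys d -> C (dyn sys z u d).

Definition max_cis (Y : set Z) : set Z :=
  \bigcup_(C in controlled_invariant Y) C.

Lemma max_cis_invariant (Y : set Z) : controlled_invariant Y (max_cis Y).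
Proof.
split=> [z [C [CY _]]|z [C CI Cz]]; first exact: CY.
have [u Uu Cu] := CI.2 z Cz.
by exists u => // d Dd; exists C => //; exact: Cu.
Qed.

Lemma max_cis_greatest (Y C : set Z) :
  controlled_invariant Y C -> C `<=` max_cis Y.
Proof. by move=> CI z Cz; exists C. Qed.

Fixpoint pre_iter (Y : set Z) (k : nat) : set Z :=
  if k is k'.+1 then pre (pre_iter Y k') `&` Y else Y.

Definition pre_limit (Y : set Z) : set Z := \bigcap_k pre_iter Y k.

End ControlledInvariance.

Section InputDelay.
Context (R : realType) (n m q tau : nat).
Context (A : 'M[R]_n) (B : 'M[R]_(n, m)) (F : 'M[R]_(n, q)).
Context (X : set 'cV[R]_n) (U : set 'cV[R]_m) (D : set 'cV[R]_q).

(* A state is (x, u) with u the tuple (u_1, ..., u_tau) of pending inputs.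
   Tuples are indexed from 0, so u_j is u`_(j - 1); aug_dyn reaches the default
   value 0 of an out-of-range index only if tau = 0. *)
Definition aug_state : Type := ('cV[R]_n * tau.-tuple 'cV[R]_m)%type.

Definition aug_dyn (z : aug_state) (v : 'cV[R]_m) (d : 'cV[R]_q) : aug_state :=
  (A *m z.1 + B *m z.2`_0 + F *m d,
   [tuple if (i.+1 < tau)%N then z.2`_i.+1 else v | i < tau]).

Definition aug_sys : system aug_state 'cV[R]_m 'cV[R]_q := System aug_dyn U D.

Definition aug_safe : set aug_state :=
  [set z | X z.1 /\ forall i : 'I_tau, U (tnth z.2 i)].

Definition aux_sys : system 'cV[R]_n 'cV[R]_m 'cV[R]_q :=
  System (fun x v d => A *m x + B *m v + A ^+ tau *m F *m d) U D.

(* The Minkowski sum of A^(i-1) F D over 1 <= i <= k. *)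
Definition dist_reach (k : nat) : set 'cV[R]_n :=
  mink_sum (fun i : 'I_k => [set A ^+ i *m F *m d | d in D]).

Definition aux_safe : set 'cV[R]_n := mink_diff X (dist_reach tau).

(* A^k x plus the sum of A^(i-1) B u_(k-i+1) over 1 <= i <= k; meant for
   k <= tau, where the indices stay within the tuple. *)
Definition predicted (k : nat) (z : aug_state) : 'cV[R]_n :=
  A ^+ k *m z.1 + \sum_(i < k) A ^+ i *m B *m z.2`_(k - i.+1).

Definition C_last : set aug_state :=
  [set z | max_cis aux_sys aux_safe (predicted tau z)].

Definition C_step (k : nat) : set aug_state :=
  [set z | mink_diff X (dist_reach k) (predicted k z)].

Definition C_ext : set aug_state :=
  (\bigcap_(k in `I_tau) C_step k) `&` C_last `&` aug_safe.

End InputDelay.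

Arguments aug_safe {R n m} tau X U _.
Arguments C_ext {R n m q} tau A B F X U D _.

(* Main.v *)
(* One step of the augmented system turns the k-step disturbance-free
   prediction into the (k+1)-step one plus A^k F d, and its tau-step prediction
   evolves exactly as the auxiliary system. Hence C_ext is invariant under the
   input that keeps the prediction in the auxiliary maximal set; conversely the
   tau-step predictions of an invariant set of the augmented system form an
   invariant set of the auxiliary one. *)
Require Import Defs.
From mathcomp Require Import all_boot all_order all_algebra.
From mathcomp Require Import all_classical all_reals all_analysis.

Set Implicit Arguments.
Unset Strict Implicit.
Unset Printing Implicit Defensive.

Import Order.TTheory GRing.Theory Num.Theory numFieldNormedType.Exports.

Local Open Scope classical_set_scope.
Local Open Scope ring_scope.

Section MinkowskiSum.
Context (V : zmodType).

Lemma mink_sum0 (S : 'I_0 -> set V) : mink_sum S = [set 0].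
Proof.
apply/seteqP; split=> [_ [y _ <-]|_ ->]; first by rewrite big_ord0.
by exists (fun=> 0); [case | rewrite big_ord0].
Qed.

(** Indexing the family by [nat] lets the same [S] serve for both [k] and [k.+1] summands, as
    inductions on the horizon need. *)
Lemma mink_sumS (k : nat) (S : nat -> set V) (x : V) :
  mink_sum (fun i : 'I_k.+1 => S i) x <->
  exists w y, [/\ mink_sum (fun i : 'I_k => S i) w, S k y & x = w + y].
Proof.
split=> [[y Sy <-]|[_ [y [[y' Sy' <-] Sy ->]]]].
  exists (\sum_(i < k) y (widen_ord (leqnSn k) i)), (y ord_max).
  split; [|exact: (Sy ord_max)|by rewrite big_ord_recr].
  by exists (fun i => y (widen_ord (leqnSn k) i)) => // i; exact: (Sy (widen_ord _ i)).
(* [y'] is extended to the top index: [insub] fails only at [k], where the default [y] is taken. *)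
exists (fun i : 'I_k.+1 => oapp y' y (insub (i : nat))) => [i /=|].
  case: insubP => [j _ <- //=|]; rewrite -leqNgt => ki.
  by have -> : i = k :> nat by apply/eqP; rewrite eqn_leq ki -ltnS ltn_ord.
rewrite big_ord_recr /= insubF ?ltnn //=; congr (_ + _).
by apply: eq_bigr => i _; rewrite valK.
Qed.

End MinkowskiSum.

Section InputDelay.
Context (R : realType) (n m q tau : nat).
Context (A : 'M[R]_n) (B : 'M[R]_(n, m)) (F : 'M[R]_(n, q)).
Context (X : set 'cV[R]_n) (U : set 'cV[R]_m) (D : set 'cV[R]_q).

Implicit Types (z : aug_state R n m tau) (v : 'cV[R]_m) (d : 'cV[R]_q).

Lemma dist_reach0 : dist_reach A F D 0 = [set 0].
Proof. exact: mink_sum0. Qed.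

Lemma dist_reachS (k : nat) (x : 'cV[R]_n) :
  dist_reach A F D k.+1 x <->
  exists w d, [/\ dist_reach A F D k w, D d & x = w + A ^+ k *m F *m d].
Proof.
rewrite /dist_reach (mink_sumS k (fun i => [set A ^+ i *m F *m d | d in D])).
split=> [[w [_ [Sw [d Dd <-] ->]]]|[w [d [Sw Dd ->]]]]; first by exists w, d.
by exists w, (A ^+ k *m F *m d); split=> //; exists d.
Qed.

Lemma predicted0 z : predicted A B 0 z = z.1.
Proof. by rewrite /predicted big_ord0 addr0 expr0 mul1mx. Qed.

Lemma aug_dyn_nth z v d (i : nat) : (i < tau)%N ->
  (aug_dyn A B F z v d).2`_i = if (i.+1 < tau)%N then z.2`_i.+1 else v.
Proof. by move=> it; rewrite -(tnth_nth 0 _ (Ordinal it)) tnth_mktuple. Qed.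

Lemma predicted_step (k : nat) z v d : (k < tau)%N ->
  predicted A B k (aug_dyn A B F z v d) =
  predicted A B k.+1 z + A ^+ k *m F *m d.
Proof.
move=> ktau; rewrite /predicted big_ord_recr /= subnn !mulmxDr !mulmxA.
rewrite mulmxE -exprSr.
under eq_bigr => i _.
  rewrite aug_dyn_nth ?(leq_ltn_trans (leq_subr _ _)) //.
  rewrite -subSn // subSS (leq_ltn_trans (leq_subr i k)) //; over.
under [in RHS]eq_bigr => i _ do rewrite subSS.
by rewrite [X in _ = _ + X + _]addrC addrA [RHS]addrAC.
Qed.

(** At horizon [tau] the term of exponent 0 reads the last entry of the tuple, which is the new
    input [v]; all other terms are those of the old prediction multiplied by [A]. *)
Lemma predicted_last_step z v d : (0 < tau)%N ->
  predicted A B tau (aug_dyn A B F z v d) =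
  A *m predicted A B tau z + B *m v + A ^+ tau *m F *m d.
Proof.
rewrite /predicted => tau0.
rewrite -(big_mkord predT (fun i => A ^+ i *m B *m _`_(tau - i.+1))).
rewrite big_ltn // expr0 mul1mx aug_dyn_nth ?subn1 ?ltn_predL // prednK // ltnn.
rewrite (eq_big_nat _ _ (F2 := fun i => A ^+ i *m B *m z.2`_(tau - i))); last first.
  move=> i /andP[i0 itau]; rewrite aug_dyn_nth ?ltn_subrL //.
  by rewrite -subSn // subSS ltn_subrL i0 tau0.
rewrite [in RHS]mulmxDr mulmx_sumr.
rewrite -(big_mkord predT (fun i => A *m (A ^+ i *m B *m z.2`_(tau - i.+1)))).
under [in RHS]eq_bigr => i _ do rewrite !mulmxA mulmxE -exprS.
rewrite -(big_add1 _ _ 0 tau.+1 predT (fun i => A ^+ i *m B *m z.2`_(tau - i))).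
rewrite big_nat_recr //= subnn !mulmxDr !mulmxA mulmxE -exprS -exprSr.
set s := \sum_(_ <= _ < _) _.
rewrite [s + _]addrC -!addrA; congr (_ + (_ + _)).
by rewrite [RHS]addrA [RHS]addrC [s + _]addrC.
Qed.

Lemma predicted_safe (C : set (aug_state R n m tau)) (k : nat) z :
  controlled_invariant (aug_sys tau A B F U D) (aug_safe tau X U) C ->
  (k <= tau)%N -> C z -> mink_diff X (dist_reach A F D k) (predicted A B k z).
Proof.
move=> [CS Cinv]; elim: k z => [|k IHk] z ktau Cz w.
  by rewrite dist_reach0 => ->; rewrite predicted0 addr0; exact: (CS z Cz).1.
move=> /dist_reachS[w' [d [Dw' Dd ->]]].
(* The top summand [A ^+ k *m F *m d] is the effect of a disturbance [d] acting now; the other [k]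
   summands are left to the induction hypothesis at the successor. *)
have [v _ Cv] := Cinv z Cz.
rewrite [w' + _]addrC addrA -(predicted_step _ v)//.
exact: IHk (ltnW ktau) (Cv d Dd) _ Dw'.
Qed.

Lemma predicted_image_invariant (C : set (aug_state R n m tau)) :
  (0 < tau)%N ->
  controlled_invariant (aug_sys tau A B F U D) (aug_safe tau X U) C ->
  controlled_invariant (aux_sys tau A B F U D) (aux_safe tau A F X D)
    (predicted A B tau @` C).
Proof.
move=> tau0 CI; split=> [_ [z Cz <-]|_ [z Cz <-]].
  exact: predicted_safe CI _ Cz.
have [v Uv Cv] := CI.2 z Cz; exists v => // d Dd /=.
by rewrite -predicted_last_step //; exists (aug_dyn A B F z v d) => //; exact: Cv.
Qed.

(** Including [k = tau], where the auxiliary maximal set lies in [aux_safe], lets one step pass from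
    horizon [k.+1] to [k] for every [k < tau]. *)
Lemma C_ext_predicted_safe (k : nat) z : (k <= tau)%N ->
  C_ext tau A B F X U D z ->
  mink_diff X (dist_reach A F D k) (predicted A B k z).
Proof.
rewrite leq_eqVlt => /orP[/eqP->|ktau] [[Cstep Clast] _]; last exact: Cstep.
exact: (max_cis_invariant _ _).1 Clast.
Qed.

Lemma C_ext_invariant : (0 < tau)%N ->
  controlled_invariant (aug_sys tau A B F U D) (aug_safe tau X U)
    (C_ext tau A B F X U D).
Proof.
move=> tau0; split=> [z [] //|z Cz].
have [[_ Clast] [_ Uz]] := Cz.
have [v Uv Cv] := (max_cis_invariant _ _).2 _ Clast.
exists v => // d Dd /=.
have step k : (k < tau)%N -> C_step A B F X D k (aug_dyn A B F z v d).
  move=> ktau w Dw; rewrite predicted_step // -addrA [_ + w]addrC.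
  by apply: C_ext_predicted_safe Cz _ _ => //; apply/dist_reachS; exists w, d.
split; [split=> [k /= ktau|]|split].
- exact: step.
- by rewrite /C_last /= predicted_last_step //; exact: Cv.
(* The successor lies in [X] by the constraint at horizon 0, whose reach set is the singleton of
   0. *)
- rewrite -[X in _ X]addr0 -[X in X + 0](predicted0 (aug_dyn A B F z v d)).
  by apply: (step 0%N tau0); rewrite dist_reach0.
- move=> i; rewrite (tnth_nth 0) aug_dyn_nth //; case: ifP => // itau.
  by rewrite -(tnth_nth 0 _ (Ordinal itau)).
Qed.

End InputDelay.

Theorem theorem1 (R : realType) (n m q tau : nat)
  (hn : (0 < n)%N) (hm : (0 < m)%N) (hq : (0 < q)%N) (htau : (0 < tau)%N)
  (A : 'M[R]_n) (B : 'M[R]_(n, m)) (F : 'M[R]_(n, q))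
  (Q X : set 'cV[R]_n) (U : set 'cV[R]_m) (D : set 'cV[R]_q)
  (hQ : polytope Q) (hX : polytope X) (hXQ : X `<=` Q)
  (hU : polytope U) (hD : polytope D)
  (haux : max_cis (aux_sys tau A B F U D) (aux_safe tau A F X D)
          = pre_limit (aux_sys tau A B F U D) (aux_safe tau A F X D))
  (haug : max_cis (aug_sys tau A B F U D) (aug_safe tau X U)
          = pre_limit (aug_sys tau A B F U D) (aug_safe tau X U)) :
  C_ext tau A B F X U D = max_cis (aug_sys tau A B F U D) (aug_safe tau X U).
Proof.
apply/seteqP; split; first exact: max_cis_greatest (C_ext_invariant _ _ _ _ _ _ htau).
have CI := max_cis_invariant (aug_sys tau A B F U D) (aug_safe tau X U).
move=> z Cz; split; [split=> [k /= ktau|]|exact: CI.1].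
- exact: predicted_safe CI (ltnW ktau) Cz.
- by apply: (max_cis_greatest (predicted_image_invariant htau CI)); exists z.
Qed.
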